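(* Let $G$ be a groupoid on a topological space $X$. Let $\mathbf{CL}$ be the category of coherent local subgroupoids of $G$ on $X$ and $\mathbf{CG}$ the category of locally coherent global (i.e. wide) subgroupoids of $G$ on $X$. Then the functors $\mathrm{glob}:\mathbf{CL}\to\mathbf{CG}$ and $\mathrm{loc}:\mathbf{CG}\to\mathbf{CL}$ form a pair of adjoint functors with $\mathrm{loc}$ left adjoint to $\mathrm{glob}$, i.e. $\mathrm{loc}\dashv\mathrm{glob}$.
   Context: $G$ is a groupoid with object set $X$, a topological space. For open $U\subseteq X$, $G|U$ is the full subgroupoid of $G$ on $U$ and $L_G(U)$ is the set of wide subgroupoids of $G|U$ (those with object set all of $U$); with restrictions $H\mapsto H|V$ this is a presheaf $L_G$ on $X$. A local subgroupoid of $G$ is a global section $s$ of the associated sheaf of germs $\mathcal{L}_G$; the germ at $x$ of $H\in L_G(U)$ is written $(U,H)_x$, and $s_x=s(x)$. For local subgroupoids $s,t$ with $s_x=(U_x,H_x)_x$, $t_x=(V_x,K_x)_x$, write $s_x\le t_x$ if $H_x|N\subseteq K_x|N$ for some open neighbourhood $N\subseteq U_x\cap V_x$ of $x$, and $s\le t$ if $s_x\le t_x$ for all $x\in X$. For $H\in L_G(X)$, $\mathrm{loc}(H)$ is the local subgroupoid $x\mapsto(X,H)_x$. For a local subgroupoid $s$, $\mathrm{glob}(s)=\bigcap\{H\in L_G(X): s\le\mathrm{loc}(H)\}$. $s$ is coherent if $s\le\mathrm{loc}(\mathrm{glob}(s))$. $H\in L_G(X)$ is locally coherent if $\mathrm{loc}(H)$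 is coherent. $\mathbf{CL}$ and $\mathbf{CG}$ are regarded as posetal categories. The direction of morphisms is: in $\mathbf{CL}$ there is a (unique) morphism $t\to s$ iff $s\le t$, and in $\mathbf{CG}$ there is a (unique) morphism $H\to K$ iff $K\subseteq H$. *)

(* Defs.v *)
From HB Require Import structures.
From mathcomp Require Import all_boot.
From mathcomp Require Import boolp classical_sets topology.

Set Implicit Arguments.
Unset Strict Implicit.
Unset Printing Implicit Defensive.

Local Open Scope classical_set_scope.

(* Composition is written in applicative order: [comp g f] is "g after f". *)
Record category (Ob : Type) := Category {
  hom : Ob -> Ob -> Type;
  idc : forall x, hom x x;
  comp : forall x y z, hom y z -> hom x y -> hom x z;
  comp1c : forall x y (f : hom x y), comp (idc y) f = f;
  compc1 : forall x y (f : hom x y), comp f (idc x) = f;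
  compcA : forall x y z w (h : hom z w) (g : hom y z) (f : hom x y),
    comp h (comp g f) = comp (comp h g) f
}.
Arguments idc {Ob} c x : rename.
Arguments comp {Ob c x y z} _ _ : rename.

Record functor (A B : Type) (C : category A) (D : category B) := Functor {
  fobj :> A -> B;
  fmap : forall a b, hom C a b -> hom D (fobj a) (fobj b);
  fmap1 : forall a, fmap (idc C a) = idc D (fobj a);
  fmapM : forall a b c (g : hom C b c) (f : hom C a b),
    fmap (comp g f) = comp (fmap g) (fmap f)
}.
Arguments fmap {A B C D} F {a b} _ : rename.

(* [left_adjoint F U] is F -| U. *)
Definition left_adjoint (A B : Type) (C : category A) (D : category B)
    (F : functor C D) (U : functor D C) : Prop :=
  exists phi : forall a b, hom D (F a) b -> hom C a (U b),
    (forall a b, bijective (phi a b)) /\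
    (forall a a' b b' (f : hom C a' a) (g : hom D b b') (h : hom D (F a) b),
       phi a' b' (comp g (comp h (fmap F f)))
       = comp (fmap U g) (comp (phi a b h) f)).

Definition posetal (T : Type) (R : T -> T -> Prop)
    (Rxx : forall a, R a a)
    (Rtr : forall a b c, R b c -> R a b -> R a c) : category T :=
  @Category T R Rxx Rtr
    (fun _ _ _ => Prop_irrelevance _ _)
    (fun _ _ _ => Prop_irrelevance _ _)
    (fun _ _ _ _ _ _ _ => Prop_irrelevance _ _).

Record groupoid (X : Type) := Groupoid {
  gcat :> category X;
  ginv : forall x y, hom gcat x y -> hom gcat y x;
  gVg : forall x y (g : hom gcat x y), comp (ginv g) g = idc gcat x;
  ggV : forall x y (g : hom gcat x y), comp g (ginv g) = idc gcat y
}.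
Arguments ginv {X} G {x y} _ : rename.

Definition full_subgroupoid (X : Type) (G : groupoid X) (U : set X) :
    groupoid {x | U x} :=
  @Groupoid {x | U x}
    (@Category {x | U x}
      (fun x y => hom G (sval x) (sval y))
      (fun x => idc G (sval x))
      (fun _ _ _ g f => comp g f)
      (fun _ _ => @comp1c _ G _ _)
      (fun _ _ => @compc1 _ G _ _)
      (fun _ _ _ _ => @compcA _ G _ _ _ _))
    (fun _ _ g => ginv G g)
    (fun _ _ => @gVg _ G _ _)
    (fun _ _ => @ggV _ G _ _).

Record wide_subgroupoid (X : Type) (G : groupoid X) := WideSubgroupoid {
  arr : forall x y, set (hom G x y);
  arr1 : forall x, arr (idc G x);
  arrM : forall x y z (g : hom G y z) (f : hom G x y),
    arr g -> arr f -> arr (comp g f);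
  arrV : forall x y (g : hom G x y), arr g -> arr (ginv G g)
}.
Arguments arr {X G} H x y _ : rename.

Definition wsub (X : Type) (G : groupoid X) (H K : wide_subgroupoid G) : Prop :=
  forall x y, arr H x y `<=` arr K x y.

Definition wbigcap (X : Type) (G : groupoid X)
    (P : set (wide_subgroupoid G)) : wide_subgroupoid G.
Proof.
refine (@WideSubgroupoid X G (fun x y g => forall H, P H -> arr H x y g) _ _ _).
- by move=> x H _; apply: arr1.
- by move=> x y z g f Pg Pf H PH; apply: arrM; [apply: Pg|apply: Pf].
- by move=> x y g Pg H PH; apply: arrV; apply: Pg.
Defined.

Section LocalSubgroupoids.
Context {X : topologicalType} (G : groupoid X).
Implicit Types (U V N : set X) (x y : X).

(* The presheaf L_G: the wide subgroupoids of G|U. *)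
Definition LG U := wide_subgroupoid (full_subgroupoid G U).

Definition incl V U (VU : V `<=` U) (a : {x | V x}) : {x | U x} :=
  exist _ (sval a) (VU _ (proj2_sig a)).

Definition restr V U (VU : V `<=` U) (H : LG U) : LG V :=
  @WideSubgroupoid _ (full_subgroupoid G V)
    (fun a b => arr H (incl VU a) (incl VU b))
    (fun a => arr1 H (incl VU a))
    (fun a b c => @arrM _ _ H (incl VU a) (incl VU b) (incl VU c))
    (fun a b => @arrV _ _ H (incl VU a) (incl VU b)).

(* The pairs (U, H) which have a germ at x. *)
Record local_datum x := LocalDatum {
  dom : set X;
  dom_open : open dom;
  dom_in : dom x;
  dom_sub : LG dom
}.

Definition same_germ x (p q : local_datum x) : Prop :=
  exists N (Np : N `<=` dom p) (Nq : N `<=` dom q),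
    [/\ open N, N x & restr Np (dom_sub p) = restr Nq (dom_sub q)].

(* A germ at x is an equivalence class of [same_germ], as a set of data. *)
Definition stalk x :=
  {c : set (local_datum x) | exists p, c = [set q | same_germ p q]}.

Definition germ U (oU : open U) x (Ux : U x) (H : LG U) : stalk x :=
  let p := LocalDatum oU Ux H in
  exist _ [set q | same_germ p q] (ex_intro _ p erefl).

(* Global sections of the associated sheaf: families of germs which are
   locally induced by a section of the presheaf; equivalently, continuous
   sections of the space of germs, whose topology has as a basis the sets
   {(U, H)_y | y in U}. *)
Record local_subgroupoid := LocalSubgroupoid {
  germ_at :> forall x, stalk x;
  germ_atP : forall x, exists U (oU : open U) (H : LG U),
    U x /\ forall y (Uy : U y), germ_at y = germ oU Uy H
}.

(* The comparison of H|N and K|N does not depend on the representatives (U, H)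
   and (V, K) of the germs, up to shrinking N. *)
Definition le_germ x (a b : stalk x) : Prop :=
  exists p q, [/\ sval a p, sval b q &
    exists N (Np : N `<=` dom p) (Nq : N `<=` dom q),
      [/\ open N, N x & wsub (restr Np (dom_sub p)) (restr Nq (dom_sub q))]].

Definition le_local (s t : local_subgroupoid) : Prop :=
  forall x, le_germ (s x) (t x).

Definition loc (H : LG [set: X]) : local_subgroupoid :=
  @LocalSubgroupoid (fun x => germ openT I H)
    (fun x => ex_intro _ setT (ex_intro _ openT (ex_intro _ H
      (conj I (fun y Uy => congr1 (fun p => germ openT p H)
                             (Prop_irrelevance I Uy)))))).

Definition glob (s : local_subgroupoid) : LG [set: X] :=
  wbigcap [set H | le_local s (loc H)].

Definition coherent (s : local_subgroupoid) : Prop := le_local s (loc (glob s)).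

Definition locally_coherent (H : LG [set: X]) : Prop := coherent (loc H).

Lemma le_localxx s : le_local s s.
Proof.
move=> x; have [p sp] := svalP (s x).
have pp : sval (s x) p.
  rewrite sp; exists (dom p), (@subset_refl _ _), (@subset_refl _ _).
  by split; [exact: dom_open|exact: dom_in|].
exists p, p; split=> //; exists (dom p), (@subset_refl _ _), (@subset_refl _ _).
by split; [exact: dom_open|exact: dom_in|move=> a b].
Qed.

Lemma wsub_restrP U V N (NU : N `<=` U) (NV : N `<=` V) (H : LG U) (K : LG V) :
  wsub (restr NU H) (restr NV K) <->
  forall x y (Nx : N x) (Ny : N y) (Ux : U x) (Uy : U y) (Vx : V x) (Vy : V y)
    (g : hom G x y),
    arr H (exist _ x Ux) (exist _ y Uy) g -> arr K (exist _ x Vx) (exist _ y Vy) g.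
Proof.
split=> [HK x y Nx Ny Ux Uy Vx Vy g|HK [x Nx] [y Ny] g]; last exact: HK.
rewrite (Prop_irrelevance Ux (NU _ Nx)) (Prop_irrelevance Uy (NU _ Ny)).
rewrite (Prop_irrelevance Vx (NV _ Nx)) (Prop_irrelevance Vy (NV _ Ny)).
exact: (HK (exist _ x Nx) (exist _ y Ny)).
Qed.

Lemma le_local_trans s t u : le_local t u -> le_local s t -> le_local s u.
Proof.
move=> tu st x.
have [p [q [sp tq [N [Np [Nq [oN Nx /wsub_restrP pq]]]]]]] := st x.
have [q' [r [tq' ur [M [Mq [Mr [oM Mx /wsub_restrP qr]]]]]]] := tu x.
have [z tz] := svalP (t x).
move: tq tq'; rewrite tz.
move=> [A [Az [Aq [oA Ax zq]]]] [B [Bz [Bq [oB Bx zq']]]].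
have /wsub_restrP {}zq : wsub (restr Aq (dom_sub q)) (restr Az (dom_sub z)).
  by rewrite zq => a b.
have /wsub_restrP {}zq' : wsub (restr Bz (dom_sub z)) (restr Bq (dom_sub q')).
  by rewrite zq' => a b.
pose W := (N `&` M) `&` (A `&` B).
have Wp : W `<=` dom p by move=> y [[/Np]].
have Wr : W `<=` dom r by move=> y [[_ /Mr]].
exists p, r; split=> //; exists W, Wp, Wr; split; [|by []|].
  by apply: openI; apply: openI.
apply/wsub_restrP => a b [[Na Ma] [Aa Ba]] [[Nb Mb] [Ab Bb]] pa pb ra rb g pg.
apply: (qr _ _ Ma Mb (Mq _ Ma) (Mq _ Mb)).
apply: (zq' _ _ Ba Bb (Bz _ Ba) (Bz _ Bb)).
apply: (zq _ _ Aa Ab (Aq _ Aa) (Aq _ Ab)).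
exact: (pq _ _ Na Nb pa pb).
Qed.

(* A morphism t -> s is an inequality s <= t. *)
Definition CL : category {s | coherent s} :=
  @posetal {s | coherent s} (fun t s => le_local (sval s) (sval t))
    (fun s => le_localxx (sval s))
    (fun _ _ _ ba cb => le_local_trans cb ba).

(* A morphism H -> K is an inclusion of K in H. *)
Definition CG : category {H | locally_coherent H} :=
  @posetal {H | locally_coherent H} (fun H K => wsub (sval K) (sval H))
    (fun _ _ _ => @subset_refl _ _)
    (fun _ _ _ ba cb a b => subset_trans (ba a b) (cb a b)).

End LocalSubgroupoids.

(* Main.v *)
Require Import Defs.
From mathcomp Require Import all_boot.
From mathcomp Require Import boolp classical_sets topology.

(** Both categories are posets, so the adjunction is the Galois connection
    <<glob s <= H  <->  s <= loc H>>, with both orders read backwards.  From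
    right to left it holds for every [s], because [H] is then one of the
    subgroupoids whose intersection is [glob s] ([glob_min]).  From left to right
    it is where coherence enters: [s <= loc (glob s)], and [loc] is monotone
    ([loc_mono]), hence [s <= loc (glob s) <= loc H].

    The same two facts show that the functors are well defined: [loc H] is
    coherent by the definition of local coherence, and for [s] coherent, applying
    the monotone maps [glob] and [loc] to [s <= loc (glob s)] gives the coherence
    of [loc (glob s)] ([glob_locally_coherent]).  All equations between
    morphisms are equalities between proofs of one proposition. *)

Set Implicit Arguments.
Unset Strict Implicit.
Unset Printing Implicit Defensive.

Section PosetalCategories.
Context {A B : Type} (R : A -> A -> Prop) (S : B -> B -> Prop)
  (Rxx : forall a, R a a) (Rtr : forall a b c, R b c -> R a b -> R a c)
  (Sxx : forall a, S a a) (Str : forall a b c, S b c -> S a b -> S a c).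

Definition monotone_functor (f : A -> B)
    (fS : forall a b, R a b -> S (f a) (f b)) :
    functor (posetal Rxx Rtr) (posetal Sxx Str) :=
  @Functor _ _ (posetal Rxx Rtr) (posetal Sxx Str) f fS
    (fun _ => @Prop_irrelevance (S _ _) _ _)
    (fun _ _ _ _ _ => @Prop_irrelevance (S _ _) _ _).

(** Mutually converse implications are inverse bijections of hom-sets, and
    naturality is automatic, since a hom-set has at most one element. *)
Lemma galois_left_adjoint (F : functor (posetal Rxx Rtr) (posetal Sxx Str))
    (U : functor (posetal Sxx Str) (posetal Rxx Rtr)) :
  (forall a b, S (F a) b <-> R a (U b)) -> left_adjoint F U.
Proof.
move=> FU; exists (fun a b => proj1 (FU a b)); split=> [a b|*].
  exists (proj2 (FU a b)) => h.
    exact: (@Prop_irrelevance (S _ _)).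
  exact: (@Prop_irrelevance (R _ _)).
exact: (@Prop_irrelevance (R _ _)).
Qed.

End PosetalCategories.

Section GlobLoc.
Local Open Scope classical_set_scope.
Context {X : topologicalType} (G : groupoid X).
Implicit Types (s t : local_subgroupoid G) (H K : LG G [set: X]).

Lemma glob_min s H : le_local s (loc H) -> wsub (glob s) H.
Proof. by move=> sH x y g; apply. Qed.

Lemma glob_mono s t : le_local s t -> wsub (glob s) (glob t).
Proof.
by move=> st x y g sg H tH; apply: sg; apply: le_local_trans tH st.
Qed.

Lemma same_germxx x (p : local_datum G x) : same_germ p p.
Proof.
exists (dom p), (@subset_refl _ _), (@subset_refl _ _).
by split; [exact: dom_open|exact: dom_in|].
Qed.

Lemma loc_mono H K : wsub H K -> le_local (loc H) (loc K).
Proof.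
move=> HK x.
exists (LocalDatum openT (I : [set: X] x) H).
exists (LocalDatum openT (I : [set: X] x) K).
split; [exact: same_germxx|exact: same_germxx|].
exists setT, (@subset_refl _ _), (@subset_refl _ _); split=> //; first exact: openT.
move=> a b; exact: (HK (incl (@subset_refl _ _) a) (incl (@subset_refl _ _) b)).
Qed.

Lemma glob_locally_coherent s : coherent s -> locally_coherent (glob s).
Proof. by move=> cs; apply/loc_mono/glob_mono. Qed.

Lemma le_loc_globP s H :
  coherent s -> le_local s (loc H) <-> wsub (glob s) H.
Proof.
move=> cs; split=> [|sH]; first exact: glob_min.
exact: le_local_trans (loc_mono sH) cs.
Qed.

Definition glob_coherent (s : {s : local_subgroupoid G | coherent s}) :
    {H : LG G [set: X] | locally_coherent H} :=
  exist (@locally_coherent _ G) (glob (sval s)) (glob_locally_coherent (svalP s)).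

Definition loc_coherent (H : {H : LG G [set: X] | locally_coherent H}) :
    {s : local_subgroupoid G | coherent s} :=
  exist (@coherent _ G) (loc (sval H)) (svalP H).

Definition globF : functor (CL G) (CG G) :=
  @monotone_functor _ _ _ _ _ _ _ _ glob_coherent
    (fun a b (ba : le_local (sval b) (sval a)) => glob_mono ba).

Definition locF : functor (CG G) (CL G) :=
  @monotone_functor _ _ _ _ _ _ _ _ loc_coherent
    (fun a b (ba : wsub (sval b) (sval a)) => loc_mono ba).

End GlobLoc.

Theorem proposition2p1p9 (X : topologicalType) (G : groupoid X) :
  exists (Glob : functor (CL G) (CG G)) (Loc : functor (CG G) (CL G)),
    [/\ forall s, sval (Glob s) = glob (sval s),
        forall H, sval (Loc H) = loc (sval H) &
        left_adjoint Loc Glob].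
Proof.
exists (globF G), (locF G); split=> //.
by apply: galois_left_adjoint => H s; apply: le_loc_globP; apply: svalP s.
Qed.
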